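(* The group $\Gamma_d(q)$ has no regular language of geodesics with respect to the generating set $S_{d,q}$; that is, there is no collection of geodesic representatives for the elements of $\Gamma_d(q)$ (with respect to $S_{d,q}$) which is accepted by a finite state automaton.
   Context: **The group.** $d\ge 2$ and $q\ge 2$ are integers such that either $d\in\{2,3\}$, or $d\ge4$ and every prime divisor of $q$ is greater than $d-1$. $\mathcal L_q$ is a commutative ring of order $q$ with unit $1$ containing distinct elements $\lambda_1,\dots,\lambda_{d-1}$ whose pairwise differences are invertible if $d\ge3$. Let $\mathcal R=\mathcal L_q[t,(t+\lambda_1)^{-1},\dots,(t+\lambda_{d-1})^{-1}]$. $\Gamma_d(q)$ is the group of matrices $\begin{pmatrix}(t+\lambda_1)^{k_1}\cdots(t+\lambda_{d-1})^{k_{d-1}}&P\\0&1\end{pmatrix}$ with $k_i\in\mathbb Z$, $P\in\mathcal R$. The generating set $S_{d,q}$ (closed under inverses) consists of the matrices $\begin{pmatrix}t+\lambda_i&b\\0&1\end{pmatrix}^{\pm1}$ ($b\in\mathcal L_q$, $1\le i\le d-1$) and $\begin{pmatrix}(t+\lambda_i)(t+\lambda_j)^{-1}&-b(t+\lambda_j)^{-1}\\0&1\end{pmatrix}$ ($b\in\mathcal L_q$, $i\ne j$ in $\{1,\dots,d-1\}$). **Geodesic representatives.** A word $s_1s_2\cdots s_n$ over $S_{d,q}$ is geodesic if the group element it represents has word length exactly $n$ with respect to $S_{d,q}$. A collection of geodesic representatives for the elements of $\Gamma_d(q)$ is a set of geodesic words over $S_{d,q}$ containing at least one word representing each element of $\Gamma_d(q)$.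 A language is regular if it is accepted by a finite state automaton. *)

(* Defs.v *)
From HB Require Import structures.
From mathcomp Require Import all_boot all_order all_algebra.
From mathcomp Require Import generic_quotient boolp ring.

Set Implicit Arguments.
Unset Strict Implicit.
Unset Printing Implicit Defensive.

Import GRing.Theory.
Local Open Scope ring_scope.

(* The ring L[t, (t + lam_i)^-1 : i < n] is the localization of {poly L} at the
   multiplicative set of the monomials m_e = \prod_i ('X + lam_i) ^+ e_i.  Its
   elements are the classes of pairs (p, e), standing for p / m_e.  The m_e are
   monic, hence not zero divisors, so that cross-multiplication without an extra
   factor is the right equivalence even when L is not a domain. *)
Module Loc.
Section Loc.
Context (L : comNzRingType) (n : nat) (lam : 'I_n -> L).

Definition dom := ({poly L} * {ffun 'I_n -> nat})%type.
HB.instance Definition _ := Choice.on dom.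
Implicit Types (x y z : dom) (e : {ffun 'I_n -> nat}).

Definition den e : {poly L} := \prod_i ('X + (lam i)%:P) ^+ e i.

Definition exp0 : {ffun 'I_n -> nat} := [ffun=> 0%N].
Definition expD e1 e2 : {ffun 'I_n -> nat} := [ffun i => (e1 i + e2 i)%N].

Lemma den0 : den exp0 = 1.
Proof. by rewrite /den big1 // => i _; rewrite ffunE expr0. Qed.

Lemma denD e1 e2 : den (expD e1 e2) = den e1 * den e2.
Proof.
by rewrite /den -big_split /=; apply: eq_bigr => i _; rewrite ffunE exprD.
Qed.

Lemma den_monic e : den e \is monic.
Proof. by apply: monic_prod => i _; apply/monic_exp/monicXaddC. Qed.

Definition equiv x y := x.1 * den y.2 == y.1 * den x.2.

Lemma equiv_refl : reflexive equiv.
Proof. by move=> x; rewrite /equiv. Qed.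

Lemma equiv_sym : symmetric equiv.
Proof. by move=> x y; rewrite /equiv eq_sym. Qed.

Lemma equiv_trans : transitive equiv.
Proof.
move=> y x z /eqP xy /eqP yz; apply/eqP/(monic_rreg (den_monic y.2)) => /=.
transitivity (x.1 * den y.2 * den z.2); first by ring.
rewrite xy; transitivity (y.1 * den z.2 * den x.2); first by ring.
by rewrite yz; ring.
Qed.

Canonical equiv_equiv := EquivRel equiv equiv_refl equiv_sym equiv_trans.

Definition type := {eq_quot equiv}%qT.
HB.instance Definition _ : EqQuotient _ equiv type := EqQuotient.on type.
HB.instance Definition _ := Choice.on type.

Local Open Scope quotient_scope.

Lemma repr_equiv x :
  x.1 * den (repr (\pi_type x)).2 = (repr (\pi_type x)).1 * den x.2.
Proof.
by apply/eqP; rewrite -[_ == _]/(equiv x _) -eqmodE; apply/eqP; rewrite reprK.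
Qed.

Definition frac p e : type := \pi_type (p, e).

Lemma frac_eq p1 e1 p2 e2 :
  (frac p1 e1 == frac p2 e2) = (p1 * den e2 == p2 * den e1).
Proof. by rewrite eqmodE. Qed.

Lemma fracP (a : type) : exists p e, a = frac p e.
Proof. by elim/quotW: a => -[p e]; exists p, e. Qed.

(* The operations are locked, because unification over matrices with entries here
   would otherwise unfold them, at prohibitive cost. *)
Fact key : Datatypes.unit. Proof. exact: tt. Qed.

Definition add : type -> type -> type := locked_with key (fun a b =>
  frac ((repr a).1 * den (repr b).2 + (repr b).1 * den (repr a).2)
       (expD (repr a).2 (repr b).2)).
Definition opp : type -> type := locked_with key (fun a =>
  frac (- (repr a).1) (repr a).2).
Definition mul : type -> type -> type := locked_with key (fun a b =>
  frac ((repr a).1 * (repr b).1) (expD (repr a).2 (repr b).2)).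

Lemma add_frac p1 e1 p2 e2 :
  add (frac p1 e1) (frac p2 e2) = frac (p1 * den e2 + p2 * den e1) (expD e1 e2).
Proof.
rewrite /add unlock; apply/eqP; rewrite frac_eq !denD; apply/eqP.
have /= E1 := repr_equiv (p1, e1); have /= E2 := repr_equiv (p2, e2).
move: E1 E2; rewrite -/(frac p1 e1) -/(frac p2 e2).
move: (repr (frac p1 e1)) (repr (frac p2 e2)) => [r s] [r' s'] /= E1 E2.
transitivity ((r * den e1) * (den s' * den e2) + (r' * den e2) * (den s * den e1)).
  by ring.
by rewrite -E1 -E2; ring.
Qed.

Lemma opp_frac p e : opp (frac p e) = frac (- p) e.
Proof.
rewrite /opp unlock; apply/eqP; rewrite frac_eq; apply/eqP.
by rewrite !mulNr; have /= <- := repr_equiv (p, e).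
Qed.

Lemma mul_frac p1 e1 p2 e2 :
  mul (frac p1 e1) (frac p2 e2) = frac (p1 * p2) (expD e1 e2).
Proof.
rewrite /mul unlock; apply/eqP; rewrite frac_eq !denD; apply/eqP.
have /= E1 := repr_equiv (p1, e1); have /= E2 := repr_equiv (p2, e2).
move: E1 E2; rewrite -/(frac p1 e1) -/(frac p2 e2).
move: (repr (frac p1 e1)) (repr (frac p2 e2)) => [r s] [r' s'] /= E1 E2.
transitivity ((r * den e1) * (r' * den e2)); first by ring.
by rewrite -E1 -E2; ring.
Qed.

Local Ltac fracs := repeat (let a := fresh "a" in move=> a;
  have [? [? {a}->]] := fracP a);
  rewrite ?(add_frac, opp_frac, mul_frac); apply/eqP;
  rewrite frac_eq !denD ?den0; apply/eqP; ring.

Fact addA : associative add. Proof. by fracs. Qed.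
Fact addC : commutative add. Proof. by fracs. Qed.
Fact add0 : left_id (frac 0 exp0) add. Proof. by fracs. Qed.
Fact addN : left_inverse (frac 0 exp0) opp add. Proof. by fracs. Qed.
HB.instance Definition _ := GRing.isZmodule.Build type addA addC add0 addN.

Fact mulA : associative mul. Proof. by fracs. Qed.
Fact mulC : commutative mul. Proof. by fracs. Qed.
Fact mul1 : left_id (frac 1 exp0) mul. Proof. by fracs. Qed.
Fact mulD : left_distributive mul add. Proof. by fracs. Qed.
Fact one_neq0 : frac 1 exp0 != frac 0 exp0.
Proof. by rewrite frac_eq den0 !mulr1 oner_eq0. Qed.
HB.instance Definition _ :=
  GRing.Zmodule_isComNzRing.Build type mulA mulC mul1 mulD one_neq0.

(* Invertibility is decided classically. *)
Definition unit : pred type := locked_with key (fun a =>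
  `[< exists b : type, b * a == 1 >]).
Definition inv : type -> type := locked_with key (fun a =>
  if pselect (exists b : type, b * a == 1) is left ex then xchoose ex else a).

Lemma unitE (a : type) : reflect (exists b : type, b * a == 1) (unit a).
Proof. by rewrite /unit unlock; apply: asboolP. Qed.

Fact mulV : {in unit, left_inverse 1 inv *%R}.
Proof.
move=> a /unitE ua; rewrite /inv unlock; case: pselect => // ex.
exact/eqP/(xchooseP ex).
Qed.
Fact unitP (a b : type) : b * a = 1 -> unit a.
Proof. by move=> ba1; apply/unitE; exists b; apply/eqP. Qed.
Fact invE : {in [predC unit], inv =1 id}.
Proof. by move=> a /unitE nua; rewrite /inv unlock; case: pselect. Qed.
HB.instance Definition _ :=
  GRing.ComNzRing_hasMulInverse.Build type mulV unitP invE.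

End Loc.
End Loc.
HB.export Loc.

Section Embedding.
Context (L : comNzRingType) (n : nat) (lam : 'I_n -> L).

Definition loc : Type := Loc.type lam.
HB.instance Definition _ := GRing.ComUnitRing.on loc.

Definition of_poly (p : {poly L}) : loc := Loc.frac lam p (Loc.exp0 n).

Fact of_poly_zmod : zmod_morphism of_poly.
Proof.
move=> p q; rewrite /of_poly -[RHS]/(Loc.add _ (Loc.opp _)).
rewrite Loc.opp_frac Loc.add_frac; apply/eqP.
by rewrite Loc.frac_eq Loc.denD !Loc.den0 !mulr1.
Qed.
HB.instance Definition _ := GRing.isZmodMorphism.Build {poly L} loc of_poly
  of_poly_zmod.

Fact of_poly_monoid : monoid_morphism of_poly.
Proof.
split=> // p q; rewrite /of_poly -[RHS]/(Loc.mul _ _) Loc.mul_frac; apply/eqP.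
by rewrite Loc.frac_eq Loc.denD !Loc.den0 !mulr1.
Qed.
HB.instance Definition _ := GRing.isMonoidMorphism.Build {poly L} loc of_poly
  of_poly_monoid.

(* t + lam_i and the constant b, as elements of L[t, (t + lam_j)^-1 : j < n] *)
Definition tl (i : 'I_n) : loc := of_poly ('X + (lam i)%:P).
Definition cst (b : L) : loc := of_poly b%:P.

Lemma of_poly_inj : injective of_poly.
Proof. by move=> p q /eqP; rewrite Loc.frac_eq !Loc.den0 !mulr1 => /eqP. Qed.

Lemma tl_unit i : tl i \is a GRing.unit.
Proof.
apply/unitrPr; pose e : {ffun 'I_n -> nat} := [ffun j => (j == i) : nat].
exists (Loc.frac lam 1 e); rewrite -[LHS]/(Loc.mul _ _) Loc.mul_frac; apply/eqP.
rewrite Loc.frac_eq Loc.denD !Loc.den0 /Loc.den (bigD1 i) //= big1.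
  by rewrite ffunE eqxx expr1 !mulr1 !mul1r.
by move=> j /negPf ji; rewrite ffunE ji expr0.
Qed.

Lemma locP (a : loc) :
  exists p (e : {ffun 'I_n -> nat}), a = of_poly p / \prod_i tl i ^+ e i.
Proof.
have [p [e ->]] := Loc.fracP a; exists p, e.
have -> : \prod_i tl i ^+ e i = of_poly (Loc.den lam e).
  by rewrite rmorph_prod; apply: eq_bigr => i _; rewrite rmorphXn.
have u : of_poly (Loc.den lam e) \is a GRing.unit.
  rewrite rmorph_prod; apply/rpred_prod => i _.
  by rewrite rmorphXn unitrX // tl_unit.
apply: (mulIr u); rewrite divrK // -[LHS]/(Loc.mul _ _) Loc.mul_frac; apply/eqP.
by rewrite Loc.frac_eq Loc.denD !Loc.den0 !mulr1.
Qed.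

End Embedding.

Section Group.
Context (L : finComUnitRingType) (n : nat) (lam : 'I_n -> L).

Local Notation R := (loc lam).

(* the matrix with rows (a, P) and (0, 1) *)
Definition aff (a P : R) : 'M[R]_2 := \matrix_(i, j)
  if i == 0 then (if j == 0 then a else P) else (if j == 0 then 0 else 1).

(* Gamma_d(q), with n = d - 1 *)
Definition Gamma (M : 'M[R]_2) : Prop :=
  exists (k : 'I_n -> int) (P : R), M = aff (\prod_i tl lam i ^ k i) P.

(* S_{d,q}, with n = d - 1; ^-1 is the inverse in the matrix ring *)
Definition gens : seq 'M[R]_2 :=
  [seq aff (tl lam i) (cst lam b) | i <- enum 'I_n, b <- enum L]
  ++ [seq (aff (tl lam i) (cst lam b))^-1 | i <- enum 'I_n, b <- enum L]
  ++ [seq aff (tl lam ij.1 / tl lam ij.2) (- cst lam b / tl lam ij.2)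
       | ij <- [seq ij <- enum {: 'I_n * 'I_n} | ij.1 != ij.2], b <- enum L].

(* the finite type of the distinct matrices occurring in gens *)
Definition letter : finType := seq_sub gens.
Definition word := seq letter.

Definition value (w : word) : 'M[R]_2 := \prod_(s <- w) val s.

Definition has_word_length (g : 'M[R]_2) (l : nat) : Prop :=
  (exists w : word, value w = g /\ size w = l) /\
  (forall w : word, value w = g -> (l <= size w)%N).

Definition geodesic (w : word) : Prop := has_word_length (value w) (size w).

Definition geodesic_representatives (C : word -> Prop) : Prop :=
  (forall w, C w -> geodesic w) /\
  (forall g, Gamma g -> exists w, C w /\ value w = g).

End Group.

Record automaton (A : finType) := Automaton {
  state : finType;
  start : state;
  final : {set state};
  step : state -> A -> state }.

Definition accepts (A : finType) (M : automaton A) (w : seq A) : bool :=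
  foldl (@step A M) (start M) w \in final M.

Definition regular (A : finType) (C : seq A -> Prop) : Prop :=
  exists M : automaton A, forall w, C w <-> accepts M w.

(* Main.v *)
(* Put u_i = t + lam_i and u_oo = 1.  The generators are the pairs
   (u_i / u_j, b / u_j) with i <> j, so a word traces a lattice path of steps
   "i up, j down" in Z^d, and the translation parts reachable along a path
   depend only on its depths m: they are the elements with a pole of order at
   most m_i at - lam_i and of degree less than m_oo.  Word length is thus the
   length of the shortest lattice path with given endpoint and depths.

   Take a translation whose orders are exactly M everywhere.  A path reaching
   depth M in every coordinate needs M steps before any coordinate gets there,
   so its length is at least (d + 1) M.  If a regular language of geodesics with
   N states contains a representative w = xyz, |xy| <= N, then all x y^k z are
   geodesic.  The drift v of y is nonzero, since otherwise y has finite order.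
   For large k the depth of x y^k z is only needed up to N in the coordinates
   with v > 0 and up to M - (k - 1) v in the others, and a path with these depths
   that starts along v and ends against it has length at most
   d M + (d + 1) N + (k - 1) |y|, which forces |w| < (d + 1) M if M is large. *)
Require Import Defs.
From mathcomp Require Import all_boot all_order all_algebra.
From mathcomp Require Import zify.

Set Implicit Arguments.
Unset Strict Implicit.
Unset Printing Implicit Defensive.

Import Order.TTheory GRing.Theory Num.Theory.

(** * Lattice paths *)

Section LatticePath.
Context (I : finType).
Implicit Types (p q : seq (I * I)) (s : I * I) (D U : seq I) (i : I).

(* In a path, the step (i, j) raises coordinate i and lowers coordinate j. *)
Definition ups p i := count (fun s => s.1 == i) p.
Definition downs p i := count (fun s => s.2 == i) p.

(* The largest depth below the origin of coordinate i along p; the truncation at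
   0 accounts for the empty prefix. *)
Fixpoint depth p i : nat :=
  if p is s :: p' then depth p' i + (s.2 == i) - (s.1 == i) else 0.

Lemma ups_cat p q i : ups (p ++ q) i = ups p i + ups q i.
Proof. exact: count_cat. Qed.

Lemma downs_cat p q i : downs (p ++ q) i = downs p i + downs q i.
Proof. exact: count_cat. Qed.

Lemma depth_cat p q i :
  depth (p ++ q) i = maxn (depth p i) (depth q i + downs p i - ups p i).
Proof.
rewrite /downs /ups; elim: p => [|s p IH] /=; first by lia.
by rewrite IH; case: (s.1 == i); case: (s.2 == i) => /=; lia.
Qed.

Lemma depth_le_downs p i : depth p i <= downs p i.
Proof.
rewrite /downs; elim: p => //= s p IH.
by case: (s.1 == i); case: (s.2 == i) => /=; lia.
Qed.

Lemma downs_le_size p i : downs p i <= size p.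
Proof. exact: count_size. Qed.

Lemma depth_attained p i :
  exists t, depth p i + ups (take t p) i = downs (take t p) i.
Proof.
elim: p => [|s p [t IH]] /=; first by exists 0.
have [le|lt] := leqP (s.1 == i) (depth p i + (s.2 == i)).
  by exists t.+1; move: IH; rewrite /ups /downs /=; lia.
by exists 0 => /=; lia.
Qed.

Lemma sum_count_pred (T : eqType) (f : T -> I) (r : seq T) :
  \sum_i count (fun x => f x == i) r = size r.
Proof.
elim: r => [|x r IH] /=; first by rewrite big1.
rewrite big_split /= IH (bigD1 (f x)) //= eqxx big1 // => i.
by rewrite eq_sym => /negPf->.
Qed.

Lemma sum_ups p : \sum_i ups p i = size p.
Proof. exact: sum_count_pred. Qed.

Lemma sum_downs p : \sum_i downs p i = size p.
Proof. exact: sum_count_pred. Qed.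

Lemma leq_count_take (T : Type) (a : pred T) m n (r : seq T) :
  m <= n -> count a (take m r) <= count a (take n r).
Proof.
by move=> mn; rewrite -(subnKC mn) takeD count_cat leq_addr.
Qed.

(* Coordinate i reaches depth M at a time t >= M, after ups (take t p) i ups, and
   the ups of all coordinates among the first M steps add up to M. *)
Lemma size_deep_path M p (i0 : I) :
  (forall i, M <= depth p i) -> #|I|.+1 * M <= size p.
Proof.
move=> deep.
have Mp : M <= size p.
  by rewrite (leq_trans (deep i0)) // (leq_trans (depth_le_downs _ _)) ?downs_le_size.
have -> : #|I|.+1 * M = \sum_i (M + ups (take M p) i).
  by rewrite big_split /= sum_ups size_takel // sum_nat_const mulSn addnC.
rewrite -sum_downs; apply: leq_sum => i _.
have [t] := depth_attained p i.
have := downs_le_size (take t p) i; have := deep i => Mi dt Et.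
have Mt : M <= t by move: (size_take_min t p); lia.
have := leq_count_take (fun s => s.1 == i) p Mt.
have : downs (take t p) i <= downs p i by rewrite -{2}(cat_take_drop t p) downs_cat leq_addr.
rewrite -!/(ups _ _); lia.
Qed.

Lemma depth_prefix p q i : downs p i <= depth (p ++ q) i + ups p i.
Proof. by rewrite depth_cat; lia. Qed.

(** * Short paths with prescribed depths and endpoint *)

Lemma ups_zip U D i : size U = size D -> ups (zip U D) i = count_mem i U.
Proof.
move=> sz; rewrite -[X in _ = count_mem i X](@unzip1_zip _ _ U D) ?sz //.
by rewrite count_map; apply: eq_count.
Qed.

Lemma downs_zip U D i : size U = size D -> downs (zip U D) i = count_mem i D.
Proof.
move=> sz; rewrite -[X in _ = count_mem i X](@unzip2_zip _ _ U D) ?sz //.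
by rewrite count_map; apply: eq_count.
Qed.

(** At time [size D1] the downs made are those of [D1], and the ups form a prefix of [U1]. *)
Lemma depth_zip U1 U2 D1 D2 i :
  size (U1 ++ U2) = size (D1 ++ D2) -> size D1 <= size U1 ->
  count_mem i D1 <= depth (zip (U1 ++ U2) (D1 ++ D2)) i + count_mem i U1.
Proof.
move=> sz le; pose U := take (size D1) U1.
have sU : size U = size D1 by rewrite size_takel.
rewrite -{1}(cat_take_drop (size D1) U1) -catA zip_cat //.
have := depth_prefix (zip U D1) (zip (drop (size D1) U1 ++ U2) D2) i.
rewrite downs_zip // => /leq_trans; apply.
rewrite leq_add2l ups_zip // /U -[in X in _ <= X](cat_take_drop (size D1) U1).
by rewrite count_cat leq_addr.
Qed.

(* A step (i, i) moves nothing, so a path can be given by an arbitrary list of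
   ups zipped with an arbitrary list of downs. *)
Definition blocks (A : pred I) (m : I -> nat) : seq I :=
  flatten [seq nseq (m i) i | i <- enum A].

Lemma count_blocks A m i : count_mem i (blocks A m) = if A i then m i else 0.
Proof.
rewrite /blocks count_flatten -map_comp sumnE big_map big_enum /=.
rewrite (eq_bigr (fun j => if j == i then m i else 0)); last first.
  by move=> j _; rewrite count_nseq /=; case: eqP => [->|]; rewrite ?mul1n.
rewrite -big_mkcondr; case: ifP => Ai; last first.
  by rewrite big1 // => j /andP[] Aj /eqP ji; move: Aj; rewrite ji unfold_in Ai.
rewrite (big_pred1 i) // => j; rewrite /= andbC.
by case: eqP => //= ->.
Qed.

Lemma size_blocks A m : size (blocks A m) = \sum_(i | A i) m i.
Proof.
rewrite /blocks size_flatten /shape -map_comp sumnE big_map big_enum /=.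
by apply: eq_bigr => i _; rewrite size_nseq.
Qed.

(** Before the last copy of [p] at most [k.-1] copies are completed, each sinking by at most the
    truncated difference; one further copy sinks by at most [N]. *)
Lemma depth_flatten_nseq k p N i : size p <= N ->
  depth (flatten (nseq k p)) i <= N + k.-1 * (downs p i - ups p i).
Proof.
move=> pN; elim: k => [|k IH] //=.
rewrite depth_cat.
have := depth_le_downs p i; have := downs_le_size p i.
case: k IH => [|k] /= IH; rewrite ?mul0n ?mulSn; first by lia.
by move: (k * _) IH => kv; lia.
Qed.

(** [m] gives the depths and [l] the final heights above [- m], so the drift is [l - m]. The ascent
    of [i0] pays for the descents of the rest of [A], and the descent of [j0] for the ascents of the
    rest of the complement; the two inequalities leave room for this. *)
Lemma exists_path (A : pred I) (m l : I -> nat) (i0 j0 : I) :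
  A i0 -> ~~ A j0 -> \sum_i m i = \sum_i l i ->
  \sum_(i | A i && (i != i0)) m i <= l i0 ->
  \sum_(i | ~~ A i && (i != j0)) l i <= m j0 ->
  exists p, [/\ size p = \sum_i m i + m i0 + l j0,
    forall i, ups p i + m i = downs p i + l i & forall i, m i <= depth p i].
Proof.
move=> A0 B0 eq_ml leA leB.
have ij : (i0 == j0) = false by apply: contraNF B0 => /eqP <-.
have ji : (j0 == i0) = false by rewrite eq_sym.
pose A' := [pred i | A i && (i != i0)]; pose B' := [pred i | ~~ A i && (i != j0)].
(* The initial [m i0] ups of [j0] and the final [l j0] downs of [i0] are compensated by the sums
   [m j0 + m i0] and [l i0 + l j0]. *)
pose D := nseq (m i0) i0 ++ blocks A' m ++ blocks B' m ++
          nseq (m j0 + m i0) j0 ++ nseq (l j0) i0.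
pose U := nseq (m i0) j0 ++ nseq (l i0 + l j0) i0 ++ blocks A' l ++ blocks B' l ++
          nseq (l j0) j0.
have sumE f : \sum_i f i =
    f i0 + f j0 + \sum_(i | A' i) f i + \sum_(i | B' i) f i :> nat.
  by rewrite (bigID A) /= (bigD1 i0) //= [X in _ + X](bigD1 j0) //= addnACA addnA.
have sD : size D = \sum_i m i + m i0 + l j0.
  by rewrite /D !size_cat !size_nseq !size_blocks sumE; lia.
have sU : size U = \sum_i l i + m i0 + l j0.
  by rewrite /U !size_cat !size_nseq !size_blocks sumE; lia.
have sUD : size U = size D by rewrite sU sD eq_ml.
exists (zip U D); split=> [|i|i].
- by rewrite size_zip sUD minnn.
- rewrite ups_zip // downs_zip // /U /D !count_cat !count_nseq !count_blocks /=.
  have [<-|i0i] := eqVneq i0 i; first by rewrite ?eqxx ?ji ?A0 /=; lia.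
  have [<-|j0i] := eqVneq j0 i; first by rewrite ?eqxx ?ij (negPf B0) /=; lia.
  by case: (A i) => /=; lia.
have dz k D1 D2 U1 U2 : D = D1 ++ D2 -> U = U1 ++ U2 -> size D1 <= size U1 ->
    count_mem k D1 <= depth (zip U D) k + count_mem k U1.
  by move=> ED EU; rewrite EU ED; apply: depth_zip; rewrite -EU -ED.
have sum2 : \sum_(i | A' i) m i + \sum_(i | B' i) m i + m i0 + m j0 =
   \sum_(i | A' i) l i + \sum_(i | B' i) l i + l i0 + l j0.
  by move: eq_ml; rewrite !sumE; clear; lia.
rewrite /= in sum2.
(* Each coordinate is tested at the end of its block in [D], before its own block of [l] ups in [U]
   begins; for [j0] the extra [m i0] downs outweigh the initial ups. *)
have [<-|i0i] := eqVneq i0 i.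
  have /= := dz i0 _ _ _ _ erefl erefl.
  by rewrite !size_nseq leqnn !count_nseq /= ji eqxx => /(_ isT); lia.
have [<-|j0i] := eqVneq j0 i.
  have := dz j0 (nseq (m i0) i0 ++ blocks A' m ++ blocks B' m ++
      nseq (m j0 + m i0) j0) (nseq (l j0) i0)
    (nseq (m i0) j0 ++ nseq (l i0 + l j0) i0 ++ blocks A' l ++ blocks B' l)
    (nseq (l j0) j0).
  rewrite !size_cat !count_cat !size_nseq !size_blocks !count_nseq !count_blocks.
  rewrite /= (negPf B0) eqxx ij /U /D -!catA => /(_ erefl erefl).
  by rewrite ?andbF /= ?mul1n ?mul0n; lia.
have [Ai|nAi] := boolP (A i).
  have := dz i (nseq (m i0) i0 ++ blocks A' m)
      (blocks B' m ++ nseq (m j0 + m i0) j0 ++ nseq (l j0) i0)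
    (nseq (m i0) j0 ++ nseq (l i0 + l j0) i0)
    (blocks A' l ++ blocks B' l ++ nseq (l j0) j0).
  rewrite !size_cat !count_cat !size_nseq !size_blocks !count_nseq !count_blocks.
  rewrite /= Ai (negPf i0i) (negPf j0i) (eq_sym i) i0i /U /D -!catA.
  move/(_ erefl erefl).
  by rewrite ?andbF /= ?mul1n ?mul0n; lia.
have := dz i (nseq (m i0) i0 ++ blocks A' m ++ blocks B' m)
    (nseq (m j0 + m i0) j0 ++ nseq (l j0) i0)
  (nseq (m i0) j0 ++ nseq (l i0 + l j0) i0 ++ blocks A' l)
  (blocks B' l ++ nseq (l j0) j0).
rewrite !size_cat !count_cat !size_nseq !size_blocks !count_nseq !count_blocks.
rewrite /= (negPf nAi) (negPf i0i) (negPf j0i) (eq_sym i j0) (negPf j0i) /U /D -!catA.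
move/(_ erefl erefl).
by rewrite ?andbF /= ?mul1n ?mul0n; lia.
Qed.
End LatticePath.

Local Open Scope ring_scope.

Lemma big_option (T : Type) (idx : T) (op : Monoid.com_law idx) (J : finType)
    (F : option J -> T) :
  \big[op/idx]_i F i = op (F None) (\big[op/idx]_j F (Some j)).
Proof.
rewrite (bigD1 None) //=; congr (op _ _).
by rewrite (reindex_omap Some id) //= => [|[j|] //]; apply: eq_bigl => j; rewrite eqxx.
Qed.

Lemma Posz_sum (J : finType) (f : J -> nat) :
  \sum_j (f j)%:Z = (\sum_j f j)%N%:Z.
Proof. by rewrite (big_morph Posz PoszD (erefl 0)). Qed.

(** * Poles and degrees in the localization *)

Section Localization.
Context (L : comUnitRingType) (n : nat) (lam : 'I_n -> L).
Local Notation I := (option 'I_n).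
Local Notation R := (loc lam).
Implicit Types (m e : I -> int) (P : R).

Definition base (i : I) : R := if i is Some k then tl lam k else 1.

Lemma base_unit i : base i \is a GRing.unit.
Proof. by case: i => [k|]; [exact: tl_unit | exact: unitr1]. Qed.

Definition monomial m : R := \prod_i base i ^ m i.

Lemma eq_monomial m m' : m =1 m' -> monomial m = monomial m'.
Proof. by move=> eqm; apply: eq_bigr => i _; rewrite eqm. Qed.

Lemma monomial0 : monomial (fun=> 0) = 1.
Proof. by rewrite /monomial big1. Qed.

Lemma monomialD m m' :
  monomial (fun i => m i + m' i) = monomial m * monomial m'.
Proof.
by rewrite -big_split; apply: eq_bigr => i _; rewrite /= exprzDr ?base_unit.
Qed.

Lemma monomial_delta i : monomial (fun k => (k == i)%:Z) = base i.
Proof.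
rewrite /monomial (bigD1 i) //= eqxx expr1z big1 ?mulr1 // => k /negPf->.
by rewrite expr0z.
Qed.

Lemma monomialN m : monomial (fun i => - m i) * monomial m = 1.
Proof.
rewrite -monomialD -monomial0; apply: eq_monomial => i; exact: addNr.
Qed.

Lemma monomial_unit m : monomial m \is a GRing.unit.
Proof. by apply/unitrPr; exists (monomial (fun i => - m i)); rewrite mulrC monomialN. Qed.

Lemma monomial_step i j :
  monomial (fun k => (k == i)%:Z - (k == j)%:Z) = base i / base j.
Proof.
apply: (mulIr (base_unit j)); rewrite divrK ?base_unit // -[in LHS]monomial_delta.
rewrite -monomialD -monomial_delta; apply: eq_monomial => k; exact: subrK.
Qed.

Definition poly_monomial (m : I -> nat) : {poly L} :=
  \prod_(k < n) ('X + (lam k)%:P) ^+ m (Some k).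

Lemma monomial_poly (m : I -> nat) :
  monomial (fun i => (m i)%:Z) = of_poly lam (poly_monomial m).
Proof.
rewrite /monomial big_option /= exp1rz mul1r rmorph_prod.
by apply: eq_bigr => k _; rewrite rmorphXn.
Qed.

Lemma poly_monomial_monic (m : I -> nat) : poly_monomial m \is monic.
Proof. by apply: monic_prod => k _; apply/monic_exp/monicXaddC. Qed.

Lemma size_poly_monomial (m : I -> nat) :
  size (poly_monomial m) = (\sum_(k < n) m (Some k)).+1.
Proof.
rewrite /poly_monomial; elim/big_rec2: _ => [|k y p _ IH]; first by rewrite size_poly1.
have mp : ('X + (lam k)%:P) ^+ m (Some k) \is monic by apply/monic_exp/monicXaddC.
rewrite size_monicM // -?size_poly_gt0 ?IH //.
rewrite -[lam k]opprK polyCN size_exp_XsubC; lia.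
Qed.

Lemma poly_monomialD (m m' : I -> nat) :
  poly_monomial (fun i => m i + m' i)%N = poly_monomial m * poly_monomial m'.
Proof. by rewrite -big_split; apply: eq_bigr => k _; rewrite exprD. Qed.

(* P has a pole of order at most m (Some k) at - lam k and degree less than
   m None; if m has negative sum, this excludes even P = 0. *)
Definition order_bounded m P :=
  exists Q : {poly L}, (size Q)%:Z <= \sum_i m i /\ P * monomial m = of_poly lam Q.

(** The numerator is multiplied by the monomial of the differences; at [None] only the degree bound
    is relaxed. *)
Lemma order_bounded_leq m m' P :
  (forall i, m i <= m' i) -> order_bounded m P -> order_bounded m' P.
Proof.
move=> le_m [Q [sQ PQ]]; pose d i := `|m' i - m i|%N.
have m'E i : m' i = m i + (d i)%:Z by rewrite /d; have := le_m i; lia.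
exists (Q * poly_monomial d); split; last first.
  rewrite rmorphM /= -PQ -monomial_poly -mulrA -monomialD.
  by congr (_ * _); apply: eq_monomial.
rewrite (eq_bigr _ (fun i _ => m'E i)) big_split /=.
have := size_polyMleq Q (poly_monomial d); rewrite size_poly_monomial => sQd.
have sum_d : (\sum_i d i = d None + \sum_(k < n) d (Some k))%N by apply: big_option.
rewrite [X in _ <= _ + X]Posz_sum sum_d.
move: sQ sQd; move: (\sum_i m i) (\sum_(k < n) d (Some k))%N (d None) (size (Q * _)) (size Q).
lia.
Qed.

Lemma order_boundedD m P P' :
  order_bounded m P -> order_bounded m P' -> order_bounded m (P + P').
Proof.
move=> [Q [sQ PQ]] [Q' [sQ' PQ']]; exists (Q + Q').
rewrite mulrDl PQ PQ' rmorphD; split=> //.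
have := size_polyD Q Q'; lia.
Qed.

Lemma order_boundedN m P : order_bounded m P -> order_bounded m (- P).
Proof.
by move=> [Q [sQ PQ]]; exists (- Q); rewrite size_polyN mulNr PQ rmorphN.
Qed.

(** The same numerator serves, since [e] and [m'] add up to [m]; the zero sum of [e] preserves the
    degree bound. *)
Lemma order_boundedM m m' e P : \sum_i e i = 0 -> (forall i, m' i = m i - e i) ->
  order_bounded m P -> order_bounded m' (monomial e * P).
Proof.
move=> e0 m'E [Q [sQ PQ]]; exists Q; split.
  by rewrite (eq_bigr _ (fun i _ => m'E i)) sumrB e0 subr0.
rewrite -PQ mulrAC -monomialD mulrC; congr (_ * _); apply: eq_monomial => i.
by rewrite m'E addrC subrK.
Qed.

Lemma order_bounded_delta i b :
  order_bounded (fun k => (k == i)%:Z) (cst lam b / base i).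
Proof.
exists b%:P; rewrite monomial_delta divrK ?base_unit //; split=> //.
rewrite (bigD1 i) //= eqxx big1 => [|k /negPf->] //.
by rewrite addr0 size_polyC; case: (b == 0).
Qed.

(** As [L] may have zero divisors, orders at [- lam k] are detected by unit values instead of
    nonzero ones. *)
Lemma monomial_horner_unit (m : I -> nat) k : m (Some k) = 0 ->
  (forall j, j != k -> lam j - lam k \is a GRing.unit) ->
  (poly_monomial m).[- lam k] \is a GRing.unit.
Proof.
move=> mk lam_k; rewrite horner_prod; apply: rpred_prod => j _.
rewrite horner_exp hornerD hornerX hornerC addrC.
have [->|jk] := eqVneq j k; first by rewrite mk expr0 unitr1.
by rewrite unitrX // lam_k.
Qed.

Lemma poly_monomial_root (m : I -> nat) k :
  (0 < m (Some k))%N -> (poly_monomial m).[- lam k] = 0.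
Proof.
move=> mk; rewrite /poly_monomial (bigD1 k) //= hornerM horner_exp.
by rewrite hornerD hornerX hornerC addNr expr0n; case: (m _) mk => //=; rewrite mul0r.
Qed.

(** * Cancelling a pole, and elements of exact order *)

Context (lam_unit : forall i j, i != j -> lam i - lam j \is a GRing.unit).

(** For finite [i] the label [b] makes the numerator vanish at [- lam k], and the factor theorem
    lowers the pole. For [None] it removes the top coefficient. Since [m i = 0], the monomial of [m]
    has a unit value at [- lam k], respectively degree exactly [\sum_k m k], so that [b] can be
    solved for. *)
Lemma order_bounded_cancel (m : I -> nat) i P : m i = 0%N ->
  order_bounded (fun k => (m k)%:Z + (k == i)%:Z) P ->
  exists b, order_bounded (fun k => (m k)%:Z) (P - cst lam b / base i).
Proof.
move=> mi0 [Q []]; rewrite big_split /= Posz_sum monomialD monomial_delta monomial_poly.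
rewrite (bigD1 i) //= mi0 add0n [X in _ + X](bigD1 i) //= eqxx.
rewrite [X in _ + (_ + X)]big1 => [|k /negPf-> //]; rewrite addr0 => sQ PQ.
have sumE : (\sum_k m k = \sum_(k | k != i) m k)%N by rewrite (bigD1 i) //= mi0.
have pE b : (P - cst lam b / base i) * of_poly lam (poly_monomial m) * base i =
    of_poly lam (Q - b%:P * poly_monomial m).
  rewrite rmorphB rmorphM /= -PQ -/(cst lam b) mulrBl mulrBl mulrA; congr (_ - _).
  by rewrite mulrAC divrK ?base_unit.
have spm : (size (poly_monomial m) <= (\sum_(k | k != i) m k).+1)%N.
  rewrite size_poly_monomial ltnS -sumE.
  have -> : (\sum_k m k = m None + \sum_(k < n) m (Some k))%N.
    exact: big_option.
  exact: leq_addl.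
rewrite -sumE in sQ spm.
have {sQ spm} sQ b : (size (Q - b%:P * poly_monomial m)%R <= (\sum_k m k).+1)%N.
  rewrite (leq_trans (size_polyD _ _)) // size_polyN geq_max mul_polyC.
  rewrite (leq_trans (size_scale_leq _ _) spm) andbT.
  by rewrite -PoszD addn1 lez_nat in sQ.
case: i mi0 sumE sQ PQ pE => [k|] mi0 _ sQ PQ pE.
  have um := monomial_horner_unit mi0 (fun j jk => lam_unit jk).
  pose b := Q.[- lam k] / (poly_monomial m).[- lam k]; exists b.
  have /factor_theorem[q qE] : root (Q - b%:P * poly_monomial m) (- lam k).
    by rewrite rootE hornerD hornerN hornerM hornerC divrK // subrr.
  exists q; rewrite Posz_sum monomial_poly; split; last first.
    apply: (mulIr (base_unit (Some k))); rewrite pE qE rmorphM /=.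
    by rewrite polyCN opprK.
  have [->|q0] := eqVneq q 0; first by rewrite size_poly0.
  have := sQ b; rewrite qE size_Mmonic ?monicXsubC // size_XsubC addn2 /=.
  by rewrite lez_nat.
have sumE : (\sum_k m k = \sum_(k < n) m (Some k))%N.
  by transitivity (m None + \sum_(k < n) m (Some k))%N; [apply: big_option | rewrite mi0].
exists Q`_(\sum_k m k); exists (Q - (Q`_(\sum_k m k))%:P * poly_monomial m).
rewrite Posz_sum monomial_poly -pE mulr1; split=> //.
rewrite lez_nat; apply/leq_sizeP => j; rewrite leq_eqVlt => /predU1P[<-|lt_j].
  rewrite coefB coefCM [X in (poly_monomial m)`_X]sumE.
  have := poly_monomial_monic m; rewrite monicE lead_coefE size_poly_monomial /=.
  by move/eqP->; rewrite mulr1 subrr.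
by rewrite nth_default // (leq_trans (sQ _)).
Qed.

(* Witness: Q / (u_1 ... u_n) ^ M, where Q has degree (n + 1) M - 1 and takes the
   value 1 at every - lam k. *)
Lemma exists_exact_order (M : nat) : (0 < n)%N -> (0 < M)%N ->
  exists P, order_bounded (fun=> M%:Z) P /\
    forall m : I -> nat, order_bounded (fun i => (m i)%:Z) P -> forall i, (M <= m i)%N.
Proof.
move=> n0 M0; pose k1 := Ordinal n0.
(* The extra [M.-1] raises the degree of [Q] from [n * M] to [n.+1 * M - 1]. *)
pose c (i : I) := if i == Some k1 then (M + M.-1)%N else M.
pose Q := 1 + poly_monomial c; pose pM := poly_monomial (fun=> M).
have sM : size pM = (n * M).+1 by rewrite size_poly_monomial sum_nat_const card_ord.
have sQ : size Q = (n.+1 * M)%N.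
  have sc : size (poly_monomial c) = (n.+1 * M)%N.
    rewrite size_poly_monomial (bigD1 k1) //= /c eqxx.
    rewrite (eq_bigr (fun=> M)); last by move=> j /negPf jk; rewrite /eq_op /= jk.
    rewrite sum_nat_const cardC1 card_ord.
    have -> : (n.+1 * M = n.-1.+2 * M)%N by rewrite prednK.
    by rewrite !mulSn; lia.
  rewrite /Q addrC size_polyDl ?size_poly1 sc //.
  by rewrite mulSn -addn1 leq_add // muln_gt0 n0.
have Q0 : Q != 0 by rewrite -size_poly_eq0 sQ muln_eq0 negb_or /= -lt0n.
exists (of_poly lam Q * monomial (fun=> - M%:Z)); split.
  exists Q; rewrite -mulrA (monomialN (fun=> M%:Z)) mulr1; split=> //.
  by rewrite Posz_sum sum_nat_const card_option card_ord sQ.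
move=> m [Q' []]; rewrite Posz_sum => sQ'.
move=> PQ; have : of_poly lam Q * monomial (fun i => (m i)%:Z) =
    of_poly lam Q' * monomial (fun=> M%:Z).
  rewrite -PQ -[LHS]mulr1 -(monomialN (fun=> M%:Z)) mulrA; congr (_ * _).
  exact: mulrAC.
rewrite !monomial_poly -!rmorphM => /(@of_poly_inj L n lam) QE.
(* At [None] the degrees of the two sides of [QE] are compared. *)
case=> [k|]; last first.
  have /(congr1 (fun p : {poly L} => size p)) := QE.
  have [Q'0|Q'0] := eqVneq Q' 0.
    rewrite Q'0 mul0r size_poly0 => /eqP; rewrite size_poly_eq0 -size_poly_eq0.
    by rewrite size_Mmonic ?poly_monomial_monic // size_poly_monomial sQ addnS /= mulSn; lia.
  rewrite !size_Mmonic ?poly_monomial_monic // -/pM sM size_poly_monomial sQ !addnS /=.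
  have sumE : (\sum_k m k = m None + \sum_(k < n) m (Some k))%N by apply: big_option.
  rewrite sumE lez_nat in sQ'; rewrite mulSn; move: sQ';
  move: (size Q') (n * M)%N (\sum_(k < n) m (Some k))%N => x y z. lia.
rewrite leqNgt; apply/negP => mk.
(* If [m (Some k) < M], the monic factor [poly_monomial d] cancels from [QE]; at [- lam k] this
   leaves a unit on the left and 0 on the right. *)
pose d i := if i == Some k then m (Some k) else 0%N.
have mE i : m i = (m i - d i + d i)%N by rewrite subnK // /d; case: eqP => // ->.
have ME i : M = (M - d i + d i)%N by rewrite subnK // /d; case: eqP => // _; apply: ltnW.
have split_pm (m' : I -> nat) : (forall i, m' i = (m' i - d i + d i)%N) ->
    poly_monomial m' = poly_monomial (fun i => m' i - d i)%N * poly_monomial d.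
  by move=> m'E; rewrite -poly_monomialD; apply: eq_bigr => j _; rewrite [in LHS]m'E.
move: QE; rewrite (split_pm _ mE) (split_pm _ ME) !mulrA.
move/(monic_rreg (poly_monomial_monic d))/(congr1 (fun p : {poly L} => p.[- lam k])).
rewrite !hornerM [X in _ = _ * X]poly_monomial_root ?mulr0; last first.
  by rewrite /d eqxx subn_gt0.
rewrite /Q hornerD hornerC poly_monomial_root; last first.
  by rewrite /c; case: ifP => _ //; rewrite addn_gt0 M0.
rewrite addr0 mul1r => pm0.
have := @monomial_horner_unit (fun i => m i - d i)%N k.
by rewrite pm0 unitr0 /d eqxx subnn => /(_ erefl (fun j jk => lam_unit jk)).
Qed.

End Localization.

(** * Words and lattice paths *)

(** By the pigeonhole principle two prefixes of length at most [#|state M|] lead to the same state;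
    the factor between them is a loop. *)
Lemma pumping (A : finType) (M : automaton A) (w : seq A) :
  (#|state M| <= size w)%N -> accepts M w ->
  exists x y z, [/\ w = x ++ y ++ z, y != [::], (size (x ++ y) <= #|state M|)%N &
    forall k, accepts M (x ++ flatten (nseq k y) ++ z)].
Proof.
move=> le_w acc_w; pose run := foldl (@step A M).
pose f (t : 'I_#|state M|.+1) := run (start M) (take t w).
have /injectivePn[t [t' tt' ft]] : ~~ injectiveb f.
  by apply/injectiveP => /leq_card; rewrite card_ord ltnn.
wlog lt_t : t t' tt' ft / (t < t')%N => [wlog_t|].
  have [lt|gt|eq] := ltngtP t t'; first exact: (wlog_t t t').
    by apply: (wlog_t t' t _ (esym ft) gt); rewrite eq_sym.
  by rewrite -(inj_eq val_inj) /= eq eqxx in tt'.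
have le_t' : (t' <= #|state M|)%N by rewrite -ltnS.
have wE : w = take t w ++ drop t (take t' w) ++ drop t' w.
  by rewrite catA -{1}(take_takel w (ltnW lt_t)) !cat_take_drop.
have sE : size (take t' w) = t' by rewrite size_takel // (leq_trans le_t').
exists (take t w), (drop t (take t' w)), (drop t' w); split=> //.
- by rewrite -size_eq0 size_drop sE subn_eq0 -ltnNge.
- by rewrite -(take_takel w (ltnW lt_t)) cat_take_drop sE.
move=> k; move: acc_w; rewrite /accepts {1}wE !foldl_cat.
have loop : run (f t) (drop t (take t' w)) = f t.
  by rewrite [RHS]ft /f /run -foldl_cat -{1}(take_takel w (ltnW lt_t)) cat_take_drop.
have loops : run (f t) (flatten (nseq k (drop t (take t' w)))) = f t.
  by elim: k => //= k IH; rewrite /run foldl_cat -/run loop.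
by rewrite -/run -/(f t) loop loops.
Qed.

Section Group.
Context (L : finComUnitRingType) (n : nat) (lam : 'I_n -> L).
Local Notation I := (option 'I_n).
Local Notation R := (loc lam).
Local Notation base := (base lam).
Local Notation monomial := (monomial lam).
Implicit Types (a P : R) (r : seq (I * I * L)) (p : seq (I * I)).

Lemma aff_inj a P a' P' : aff a P = aff a' P' -> a = a' /\ P = P'.
Proof.
move=> /matrixP E; split; first by have := E 0 0; rewrite !mxE.
by have := E 0 1; rewrite !mxE.
Qed.

Lemma aff10 : aff (1 : R) 0 = 1.
Proof.
apply/matrixP => i j; rewrite !mxE.
by case: i => [[|[|]]] //= hi; case: j => [[|[|]]].
Qed.

Lemma affM a P a' P' : aff a P * aff a' P' = aff (a * a') (P + a * P').
Proof.
apply/matrixP => i j; rewrite !mxE big_ord_recl big_ord1 !mxE /=.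
case: i => [[|[|]]] //= hi; case: j => [[|[|]]] //= hj;
  by rewrite ?(mulr0, mul0r, addr0, mulr1, mul1r, add0r) // addrC.
Qed.

(** The common form of all generators: the three families of [gens] are the cases [x.1.2 = None],
    [x.1.1 = None] and neither, with signs absorbed by the label. *)
Definition step_matrix (x : I * I * L) :=
  aff (base x.1.1 / base x.1.2) (cst lam x.2 / base x.1.2).

Lemma aff_inv (a : R) P : a \is a GRing.unit -> (aff a P)^-1 = aff a^-1 (- P / a).
Proof.
move=> ua; have AB : aff a P * aff a^-1 (- P / a) = 1.
  by rewrite affM mulrV // mulrCA mulrV // mulr1 subrr aff10.
have BA : aff a^-1 (- P / a) * aff a P = 1.
  by rewrite affM mulVr // mulNr mulrC addNr aff10.
have uA : aff a P \is a GRing.unit by apply/unitrP; exists (aff a^-1 (- P / a)).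
by rewrite -[LHS]mulr1 -AB mulKr.
Qed.

Lemma letter_step (s : letter lam) :
  exists x, x.1.1 != x.1.2 /\ val s = step_matrix x.
Proof.
have := valP s; rewrite /gens !mem_cat => /or3P[] /allpairsP[[i b] /= [+ _ ->]].
- move=> _; exists (Some i, None, b); split=> //.
  by rewrite /step_matrix /= !divr1.
- move=> _; exists (None, Some i, - b); split=> //.
  by rewrite /step_matrix /= aff_inv ?tl_unit // div1r /cst polyCN rmorphN.
case: i => [i j]; rewrite mem_filter => /andP[ij _].
exists (Some i, Some j, - b); split=> //.
by rewrite /step_matrix /= /cst polyCN rmorphN.
Qed.

Lemma step_letter (x : I * I * L) : x.1.1 != x.1.2 ->
  exists s : letter lam, val s = step_matrix x.
Proof.
move=> ij; suff sx : step_matrix x \in gens lam by exists (SeqSub sx).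
case: x ij => [[[i|] [j|]] b] //= ij; rewrite /gens !mem_cat; apply/or3P.
- apply: Or33; apply/allpairsP; exists ((i, j), - b).
  rewrite /= mem_filter !mem_enum ij; split=> //.
  by rewrite /step_matrix /= /cst polyCN rmorphN opprK.
- apply: Or31; apply/allpairsP; exists (i, b); rewrite !mem_enum.
  by split=> //; rewrite /step_matrix /= !divr1.
- apply: Or32; apply/allpairsP; exists (j, - b); rewrite !mem_enum.
  split=> //; rewrite /step_matrix /= aff_inv ?tl_unit // div1r.
  by rewrite /cst polyCN rmorphN opprK.
Qed.

(** * Translation parts along a path *)

Definition drift p (i : I) : int := (ups p i)%:Z - (downs p i)%:Z.

Lemma sum_drift p : \sum_i drift p i = 0.
Proof. by rewrite sumrB !Posz_sum sum_ups sum_downs subrr. Qed.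

Lemma drift_cat p q i : drift (p ++ q) i = drift p i + drift q i.
Proof. by rewrite /drift ups_cat downs_cat; lia. Qed.

Lemma monomial_drift_cat p q :
  monomial (drift (p ++ q)) = monomial (drift p) * monomial (drift q).
Proof.
by rewrite -monomialD; apply: eq_monomial => i; rewrite drift_cat.
Qed.

Lemma monomial_drift_cons (s : I * I) p :
  monomial (drift (s :: p)) = base s.1 / base s.2 * monomial (drift p).
Proof.
rewrite -cat1s monomial_drift_cat -monomial_step; congr (_ * _).
apply: eq_monomial => k; rewrite /drift /ups /downs /= !addn0.
by rewrite [k == _]eq_sym [k == s.2]eq_sym.
Qed.

Fixpoint translation r : R :=
  if r is x :: r' then
    cst lam x.2 / base x.1.2 + base x.1.1 / base x.1.2 * translation r'
  else 0.

Definition path_of r : seq (I * I) := [seq x.1 | x <- r].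

Lemma translation_cat r r' : translation (r ++ r') =
  translation r + monomial (drift (path_of r)) * translation r'.
Proof.
elim: r => [|x r IH] /=.
  by rewrite add0r -[LHS]mul1r -(monomial0 lam); congr (_ * _); apply: eq_monomial.
by rewrite IH monomial_drift_cons mulrDr addrA mulrA.
Qed.

Lemma prod_step_matrix r :
  \prod_(x <- r) step_matrix x = aff (monomial (drift (path_of r))) (translation r).
Proof.
elim: r => [|x r IH] /=.
  by rewrite big_nil -aff10 -(monomial0 lam); congr (aff _ _); apply: eq_monomial.
by rewrite big_cons IH affM monomial_drift_cons.
Qed.

(** The first step [(i, j)] adds a term bounded by 1 at [j], and its factor [base i / base j] shifts
    the bounds of the rest just as [depth] recurses. Since [i <> j], the depth at [j] is at least
    1. *)
Lemma translation_bounded r : all (fun x => x.1.1 != x.1.2) r ->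
  order_bounded (fun i => (depth (path_of r) i)%:Z) (translation r).
Proof.
elim: r => [_|x r IH /= /andP[ij /IH Pr]].
  exists 0; split; first by rewrite size_poly0; apply: sumr_ge0.
  by rewrite mul0r raddf0.
apply: order_boundedD.
  apply: (@order_bounded_leq _ _ _ (fun k => (k == x.1.2)%:Z)) => [i|]; last first.
    exact: order_bounded_delta.
  by have [->|] := eqVneq i x.1.2; rewrite //= lez_nat (negPf ij) ?eqxx subn0 addn1.
apply: (@order_bounded_leq _ _ _ (fun i => (depth (path_of r) i)%:Z -
    ((i == x.1.1)%:Z - (i == x.1.2)%:Z))) => [i|].
  by rewrite ![i == _]eq_sym; case: eqP; case: eqP; lia.
rewrite -monomial_step; apply: order_boundedM Pr => //.
rewrite sumrB !Posz_sum (bigD1 x.1.1) //= big1 ?eqxx => [|i /negPf-> //].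
by rewrite (bigD1 x.1.2) //= big1 ?eqxx ?subrr => // i /negPf->.
Qed.

Context (lam_unit : forall i j, i != j -> lam i - lam j \is a GRing.unit).

(* The first step (i, j) divides the translation by u_i / u_j, which can raise the
   admissible order at i above depth p i only if depth p i = 0; then the label b
   of the step is used to lower it again. *)
Lemma realize p P : order_bounded (fun i => (depth p i)%:Z) P ->
  exists w : word lam, (size w <= size p)%N /\
    value w = aff (monomial (drift p)) P.
Proof.
elim: p P => [|[i j] p IH] P bP.
  (* All depths are 0, so the numerator has size 0 and [P = 0]. *)
  exists [::]; split=> //; rewrite /value big_nil -aff10 -(monomial0 lam).
  have [Q []] := bP; rewrite Posz_sum big1 // lez_nat leqn0 size_poly_eq0 => /eqP->.
  move=> P0; have {P0} -> : P = 0.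
    apply: (mulIr (monomial_unit lam (fun i => (depth [::] i)%:Z))).
    by apply: (etrans P0); rewrite mul0r; apply: raddf0.
  by congr (aff _ _); apply: eq_monomial.
(* A step [(i, i)] is no generator but moves nothing; it is dropped, so [w] may be shorter than the
   path. *)
have [eij|ij] := eqVneq i j.
  move: bP; rewrite -{j}eij => bP.
  have depthE k : depth ((i, i) :: p) k = depth p k by rewrite /= addnK.
  have [] := IH P; first by apply: order_bounded_leq bP => k; rewrite depthE.
  move=> w [sw vw]; exists w; rewrite (leq_trans sw) // monomial_drift_cons.
  by rewrite divrr ?base_unit // mul1r.
(* After a first step with label [b], the rest must realize [P' - b / base i]. *)
pose P' := base j / base i * P.
have bP' : order_bounded (fun k => (depth ((i, j) :: p) k)%:Z -
    ((k == j)%:Z - (k == i)%:Z)) P'.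
  rewrite /P' -monomial_step; apply: order_boundedM bP => //.
  rewrite sumrB !Posz_sum (bigD1 j) //= big1 ?eqxx => [|k /negPf-> //].
  by rewrite (bigD1 i) //= big1 ?eqxx ?subrr // => k /negPf->.
have [b bb] : exists b, order_bounded (fun k => (depth p k)%:Z) (P' - cst lam b / base i).
  have [di|di] := posnP (depth p i).
    apply: order_bounded_cancel => //; apply: order_bounded_leq bP' => k /=.
    rewrite ![k == _]eq_sym; have [<-|ik] := eqVneq i k.
      by rewrite eq_sym (negPf ij) di.
    by case: (j == k); lia.
  exists 0; rewrite /cst raddf0 mul0r subr0; apply: order_bounded_leq bP' => k /=.
  rewrite ![k == _]eq_sym; have [<-|ik] := eqVneq i k.
    by rewrite eq_sym (negPf ij); lia.
  by case: (j == k); lia.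
have [w [sw vw]] := IH _ bb; have [s sE] := @step_letter (i, j, b) ij.
exists (s :: w); split=> //; rewrite /value big_cons -/(value w) vw sE affM.
rewrite monomial_drift_cons /P' /=; congr (aff _ _); rewrite mulrBr !mulrA.
rewrite divrK ?base_unit // divrr ?base_unit // mul1r.
rewrite [_ * cst lam b / _]mulrC 2!mulrA mulVr ?base_unit // mul1r mulrC.
by rewrite addrC subrK.
Qed.

(* The translation b |-> b + 1 permutes the terms of the sum of all b. *)
Lemma card_natr0 : #|L|%:R = 0 :> L.
Proof.
apply: (addrI (\sum_(b : L) b)); rewrite addr0.
rewrite [RHS](reindex_inj (addIr 1)) big_split /= sumr_const; congr (_ + _).
Qed.

Lemma mulrn_card P : P *+ #|L| = 0.
Proof.
rewrite -mulr_natl; have -> : #|L|%:R = of_poly lam (#|L|%:R)%:P.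
  by rewrite polyC_natr rmorph_nat.
by rewrite card_natr0 (raddf0 (of_poly lam)) mul0r.
Qed.

Lemma aff1X P k : aff 1 P ^+ k = aff 1 (P *+ k).
Proof.
elim: k => [|k IH]; first by rewrite aff10.
by rewrite exprS IH affM !mul1r mulrS.
Qed.

Lemma drift_pow p k i : drift (flatten (nseq k p)) i = drift p i *+ k.
Proof.
elim: k => [|k IH] //=.
by rewrite drift_cat IH mulrS.
Qed.

Lemma value_cat (w w' : word lam) : value (w ++ w') = value w * value w'.
Proof. exact: big_cat. Qed.

Lemma value_pow (w : word lam) k : value (flatten (nseq k w)) = value w ^+ k.
Proof.
elim: k => [|k IH]; first by rewrite /value big_nil.
by rewrite exprS -IH -value_cat.
Qed.

(** * Pumping a geodesic representative *)

Lemma no_regular_representatives (C : word lam -> Prop) : (0 < n)%N ->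
  geodesic_representatives C -> ~ regular C.
Proof.
move=> n0 [geoC repC] [M CM]; pose N := #|state M|.
(* The final count needs [n.+2 * m0 > n.+1 * m0 + n.+2 * N]. The size of [K] provides the two
   inequalities of [exists_path]. *)
have [m0 m0E] : exists m0, m0 = (N * n.+2).+1 by eexists.
have [K KE] : exists K, K = (n.+1 * m0)%N by eexists.
have m0_gt0 : (0 < m0)%N by rewrite m0E.
have Nm0 : (N <= m0)%N by rewrite m0E mulnS; lia.
have cardI : #|{: I}| = n.+1 by rewrite card_option card_ord.
have [lab labP] := fin_all_exists letter_step.
pose path w := path_of (map lab w); pose tr w := translation (map lab w).
have valueE w : value w = aff (monomial (drift (path w))) (tr w).
  rewrite -prod_step_matrix big_map; apply: eq_bigr => s _.
  by have [_ ->] := labP s.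
have size_path w : size (path w) = size w by rewrite !size_map.
have path_cat w w' : path (w ++ w') = path w ++ path w' by rewrite /path /path_of !map_cat.
have path_pow k w : path (flatten (nseq k w)) = flatten (nseq k (path w)).
  by rewrite /path /path_of !map_flatten !map_nseq.
have tr_cat w w' : tr (w ++ w') = tr w + monomial (drift (path w)) * tr w'.
  by rewrite /tr map_cat translation_cat.
have tr_bounded w : order_bounded (fun i => (depth (path w) i)%:Z) (tr w).
  by apply: translation_bounded; apply/allP => _ /mapP[s _ ->]; case: (labP s).
have [P0 [bP0 exact_P0]] := exists_exact_order lam_unit n0 m0_gt0.
have [w [Cw vw]] : exists w, C w /\ value w = aff 1 P0.
  by apply: repC; exists (fun=> 0), P0; rewrite big1.
have [driftw trw] : monomial (drift (path w)) = 1 /\ tr w = P0.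
  by apply: aff_inj; rewrite -valueE.
have sw : (n.+2 * m0 <= size w)%N.
  rewrite -size_path -cardI; apply: (size_deep_path None).
  by apply: exact_P0; rewrite -trw.
have Nw : (N <= size w)%N by rewrite (leq_trans Nm0) // (leq_trans _ sw) // leq_pmull.
have [x [y [z [wE y0 sxy acc]]]] := pumping Nw (proj1 (CM w) Cw).
have geo k w' : value w' = value (x ++ flatten (nseq k y) ++ z) ->
    (size (x ++ flatten (nseq k y) ++ z) <= size w')%N.
  by have [_ geo] := geoC _ (proj2 (CM _) (acc k)); apply: geo.
have sy : (0 < size y)%N by rewrite lt0n size_eq0.
pose v := drift (path y).
have sum_v : \sum_i v i = 0 by apply: sum_drift.
have [/existsP[i0 vi0]|/existsPn v_le0] := boolP [exists i, 0 < v i]; last first.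
  have v0 i : v i = 0.
    have : \sum_i - v i = 0 by rewrite sumrN sum_v oppr0.
    move/psumr_eq0P => v0; apply: oppr_inj; rewrite oppr0; apply: v0 => // j _.
    by rewrite oppr_ge0 leNgt v_le0.
  have vy : value y = aff 1 (tr y).
    by rewrite valueE (eq_monomial _ v0) monomial0.
  (* y has order dividing #|L|, so x y^#|L| z can be shortened to x z *)
  have := geo #|L| (x ++ z); rewrite !value_cat value_pow vy aff1X mulrn_card aff10 mul1r.
  move/(_ erefl); rewrite !size_cat size_flatten /shape map_nseq sumn_nseq.
  have L0 : (0 < #|L|)%N by apply/card_gt0P; exists 0.
  have : (0 < size y * #|L|)%N by rewrite muln_gt0 sy.
  lia.
have [j0 vj0] : exists j0, v j0 < 0.
  apply/existsP; apply: contraLR vi0 => /existsPn v_ge0; rewrite -leNgt.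
  have := sum_v; move/psumr_eq0P => -> // j _.
  by rewrite leNgt v_ge0.
(* [m] is a sufficient depth once [K] further copies of [y] are inserted: where [v > 0] their rise
   exceeds [m0], elsewhere their drop adds to [m0]. [l] is chosen so that [l - m] is [v] times
   [K]. *)
pose m i := if 0 < v i then N else (m0 + K * `|v i|)%N.
pose l i := if 0 < v i then (N + K * `|v i|)%N else m0.
have lE i : (l i)%:Z = (m i)%:Z + v i *+ K.
  by rewrite /l /m -mulr_natr; case: ltrP; lia.
have K0 : (m0 <= K)%N by rewrite KE leq_pmull.
have [p [sp driftp depthp]] : exists p, [/\ size p = (\sum_i m i + m i0 + l j0)%N,
    forall i, (ups p i + m i = downs p i + l i)%N & forall i, (m i <= depth p i)%N].
  have le_sum (A : pred I) f : (forall i, A i -> f i <= m0)%N ->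
      (\sum_(i | A i) f i <= K)%N.
    move=> le_f; rewrite KE -cardI -sum_nat_const.
    by rewrite [leqRHS](bigID A) /= (leq_trans _ (leq_addr _ _)) // leq_sum.
  apply: (@exists_path _ (fun i => 0 < v i)) => //.
  - by rewrite -leNgt ltW.
  - apply/eqP; rewrite -eqz_nat -!Posz_sum (eq_bigr _ (fun i _ => lE i)) big_split /=.
    by rewrite sumrMnl sum_v mul0rn addr0.
  - apply: leq_trans (le_sum _ _ _) _ => [i /andP[vi _]|]; first by rewrite /m vi.
    rewrite /l vi0; apply: leq_trans (leq_addl _ _); rewrite leq_pmulr //; lia.
  - apply: leq_trans (le_sum _ _ _) _ => [i /andP[/negPf vi _]|]; first by rewrite /l vi.
    rewrite /m ltNge ltW //=; apply: leq_trans (leq_addl _ _).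
    by rewrite leq_pmulr //; lia.
pose wK := x ++ flatten (nseq K.+1 y) ++ z.
have driftK i : drift p i = v i *+ K by have := lE i; have := driftp i; rewrite /drift; lia.
(* [tr z] is eliminated by means of [tr w = P0]. *)
have trK : tr wK = tr (x ++ flatten (nseq K.+1 y)) +
    monomial (fun i => v i *+ K) * (P0 - tr (x ++ y)).
  rewrite -trw wE /wK !catA tr_cat; congr (_ + _); rewrite [tr ((x ++ y) ++ z)]tr_cat.
  rewrite addrC addKr mulrA -monomialD; congr (_ * _); apply: eq_monomial => i.
  by rewrite !path_cat path_pow !drift_cat drift_pow [LHS]addrC.
have bK : order_bounded (fun i => (m i)%:Z) (tr wK).
  rewrite trK; apply: order_boundedD.
    (* Apart from the drop over [K] periods, the depth is at most [size x + size y <= N]. *)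
    apply: order_bounded_leq (tr_bounded _) => i; rewrite lez_nat path_cat path_pow.
    rewrite depth_cat geq_max.
    have := depth_flatten_nseq K.+1 i (leqnn (size (path y))); rewrite /= => dy.
    have dx := leq_trans (depth_le_downs (path x) i) (downs_le_size (path x) i).
    have ux := downs_le_size (path x) i; rewrite !size_path in dx ux dy.
    rewrite size_cat in sxy; rewrite /m /v /drift.
    case: ltrP => vi.
      have du0 : (downs (path y) i - ups (path y) i = 0)%N by lia.
      by rewrite du0 muln0 in dy; lia.
    have -> : `|(ups (path y) i)%:Z - (downs (path y) i)%:Z|%N =
      (downs (path y) i - ups (path y) i)%N by lia.
    by move: (K * _)%N dy => c dy; lia.
  (* [P0 - tr (x ++ y)] is bounded by [m0 >= N]; where [v > 0], the shift by at least [K >= m0]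
     leaves nothing. *)
  apply: (@order_bounded_leq _ _ _ (fun i => m0%:Z - v i *+ K)) => [i|].
    rewrite /m -mulr_natr; case: ltrP => vi; last by lia.
    have : m0%:Z <= v i * K%:R by nia.
    lia.
  apply: order_boundedM => [|//|]; first by rewrite sumrMnl sum_v mul0rn.
  apply: order_boundedD => //; apply: order_boundedN.
  apply: order_bounded_leq (tr_bounded _) => i; rewrite lez_nat.
  apply: leq_trans (depth_le_downs _ _) _; apply: leq_trans (downs_le_size _ _) _.
  by rewrite size_path (leq_trans sxy).
have bp : order_bounded (fun i => (depth p i)%:Z) (tr wK).
  by apply: order_bounded_leq bK => i; rewrite lez_nat.
have [w' [sw' vw']] := realize bp.
have : (size wK <= size p)%N.
  apply: leq_trans sw'; apply: geo; rewrite vw' valueE; congr (aff _ _).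
  rewrite /wK !path_cat path_pow.
  (* The drift of [p] is that of the inserted copies alone; [w] has the trivial monomial, so its
     drift may be added. *)
  rewrite -[LHS]mulr1 -driftw wE -monomialD; apply: eq_monomial => i.
  rewrite driftK !path_cat !drift_cat drift_pow /v.
  by move: (_ *+ K) => vK; lia.
(* The drops where [v <= 0] total at most the number of downs in [y], which is [size y]; at [i0] no
   [m0] is paid. *)
have sum_m : (\sum_i m i <= n.+1 * N + n * m0 + K * size y)%N.
  have : (\sum_i m i <= \sum_i (N + (if i == i0 then 0 else m0) + K * downs (path y) i))%N.
    apply: leq_sum => i _; rewrite /m; case: ifP => vi; first by rewrite -addnA leq_addr.
    have -> : (i == i0) = false by apply: contraFF vi => /eqP->.
    rewrite -addnA; apply: leq_trans (leq_addl _ _); rewrite leq_add2l leq_mul2l.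
    by move/negbT: vi; rewrite -leNgt /v /drift; lia.
  rewrite !big_split /= sum_nat_const cardI -big_distrr /= sum_downs size_path.
  move=> /leq_trans; apply; rewrite leq_add2r leq_add2l.
  rewrite (bigD1 i0) //= eqxx (eq_bigr (fun=> m0)) => [|i /negPf->] //.
  by rewrite sum_nat_const cardC1 cardI.
have -> : size wK = (size w + K * size y)%N.
  rewrite wE /wK !size_cat size_flatten /shape map_nseq sumn_nseq mulnC; lia.
have mi0 : m i0 = N by rewrite /m vi0.
have lj0 : l j0 = m0 by rewrite /l ltNge ltW.
rewrite sp mi0 lj0.
(* The terms [K * size y] cancel, leaving [m0 <= n.+2 * N]. *)
move: sum_m sw m0E; rewrite -/N !mulSn !mulnS [(N * n)%N]mulnC.
move: (\sum_i _)%N (K * _)%N (n * N)%N (n * m0)%N; lia.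
Qed.
End Group.

Theorem corollary16 (d q : nat) (hd : (2 <= d)%N) (hq : (2 <= q)%N)
  (hdq : d = 2%N \/ d = 3%N \/
    ((4 <= d)%N /\ forall p : nat, prime p -> (p %| q)%N -> (d - 1 < p)%N))
  (L : finComUnitRingType) (cardL : #|L| = q)
  (lam : 'I_(d - 1) -> L) (lam_inj : injective lam)
  (lam_unit : (3 <= d)%N ->
    forall i j : 'I_(d - 1), i != j -> lam i - lam j \is a GRing.unit) :
  ~ exists C : word lam -> Prop, geodesic_representatives C /\ regular C.
Proof.
move=> [C [geoC regC]]; apply: no_regular_representatives geoC regC; last by lia.
(* For [d = 2] there is a single index, which contradicts [i != j]. *)
move=> i j ij; have [d3|d2] := leqP 3 d; first exact: lam_unit.
case/eqP: ij; apply: ord_inj; have := ltn_ord i; have := ltn_ord j; lia.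
Qed.
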